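(* Let $G$ be a signed graph and let $\hat G$ be obtained from $G$ by replacing each edge $e$ by a chain or a sheaf as in the context. Colour each edge $e$ of $G$ by $c_n$ if it is replaced by a chain of length $n$ and by $s_n$ if it is replaced by a sheaf of width $n$. In the colored-graph polynomial $W(G)(t,z_1,z_2)$ set $$x_{c_n}=A^n,\quad y_{c_n}=\frac{X^n-A^n}{d},\qquad x_{s_n}=\frac{Y^n-B^n}{d},\quad y_{s_n}=B^n .$$ Then $Q[\hat G]=W(G)(d,d,d)$. If all lengths and widths are positive this is an identity in $\mathbb{Z}[A,B,d]$ with $X=A+Bd$, $Y=Ad+B$; in general (lengths/widths arbitrary nonzero integers) it holds after the substitution $B=A^{-1}$, $d=-A^2-A^{-2}$, $X=-A^{-3}$, $Y=-A^3$.
   Context: Graphs are finite and may have loops and multiple edges. A signed graph is a graph with a sign $s(e)\in\{+,-\}$ on each edge. $E_n$ is the edgeless graph on $n$ vertices; $G-e$, $G/e$ denote deletion and contraction. Put $X=A+Bd$, $Y=Ad+B$. The polynomial $Q[G]\in\mathbb{Z}[A,B,d]$ is the well-defined invariant of signed graphs determined by: $Q[E_n]=d^{n-1}$; for a loop $e$: $Q[G]=XQ[G-e]$ if $s(e)=-$, $Q[G]=YQ[G-e]$ if $s(e)=+$; for a non-loop $e$: $Q[G]=AQ[G-e]+BQ[G/e]$ if $s(e)=-$, $Q[G]=BQ[G-e]+AQ[G/e]$ if $s(e)=+$. Replacement: $\hat G$ is obtained by replacing each edge $e$ with ends $u,v$ either by a chain (a path of $k\ge1$ edges from $u$ to $v$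 through new vertices) or by a sheaf ($k\ge 1$ parallel edges between $u$ and $v$, loops if $u=v$), all new edges having sign $s(e)$; with $\pm$ identified with $\pm1$, the length of the chain (width of the sheaf) is the sum of signs of its edges. Colored-graph polynomial: for a graph $G$ with edge colouring $c:E(G)\to\Lambda$ and indeterminates $x_\lambda,y_\lambda$ ($\lambda\in\Lambda$), $t,z_1,z_2$, $$W(G)=t^{k(G)-1}\sum_{S\subseteq E(G)}\Big(\prod_{e\in S}x_{c(e)}\Big)\Big(\prod_{e\notin S}y_{c(e)}\Big)z_1^{k\langle S\rangle-k(G)}z_2^{n\langle S\rangle},$$ where $k(G)$, $k\langle S\rangle$ are numbers of components of $G$ and of the spanning subgraph with edge set $S$, and $n\langle S\rangle=|S|-|V(G)|+k\langle S\rangle$. *)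

(* Defs.v *)
From mathcomp Require Import all_boot all_order all_algebra fraction.
From mathcomp Require Import mpoly zify ring.

Set Implicit Arguments.
Unset Strict Implicit.
Unset Printing Implicit Defensive.

Import GRing.Theory.
Local Open Scope ring_scope.

(* Finite multigraphs with loops. The order of the two ends of an edge is an
   auxiliary choice: no notion below depends on it up to isomorphism. *)
Record graph := Graph {
  vertex : finType;
  edge : finType;
  ends : edge -> vertex * vertex
}.

(* [sign e = true] encodes s(e) = +, [sign e = false] encodes s(e) = -. *)
Record sgraph := SGraph {
  under :> graph;
  sign : edge under -> bool
}.

Section GraphOps.
Variable G : graph.
Implicit Types (e : edge G) (w : vertex G) (S : {set edge G}).

Definition is_loop e := (ends e).1 == (ends e).2.

Definition adj S : rel (vertex G) :=
  [rel u v | [exists e in S, (ends e == (u, v)) || (ends e == (v, u))]].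

(* k<S>: number of components of the spanning subgraph with edge set S. *)
Definition ncomp S : nat := n_comp (adj S) predT.

Definition ncompG : nat := ncomp [set: edge G].

(* n<S> = |S| - |V| + k<S>; the truncated subtraction is exact, see
   [nullity_ge0]. *)
Definition nullity S : nat := (#|S| + ncomp S - #|vertex G|)%N.

Definition other_edge e : finType := {f : edge G | f != e}.

Definition delete e : graph :=
  @Graph (vertex G) (other_edge e) (fun f => ends (val f)).

(* In G/e the second end of e is merged into the first one; if e is a loop,
   all vertices are kept and G/e is G-e. *)
Definition kept e w := (w != (ends e).2) || is_loop e.

Definition merge_vertex e w := if w == (ends e).2 then (ends e).1 else w.

Lemma kept_merge e w : kept e (merge_vertex e w).
Proof.
rewrite /kept /merge_vertex /is_loop; case: ifP => [_|->] //.
by rewrite orNb.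
Qed.

Definition contr_vertex e : finType := {w : vertex G | kept e w}.

Definition to_contr e w : contr_vertex e :=
  @exist _ (fun w' => kept e w') _ (kept_merge e w).

Definition contract e : graph :=
  @Graph (contr_vertex e) (other_edge e)
    (fun f => (to_contr e (ends (val f)).1, to_contr e (ends (val f)).2)).

End GraphOps.

Definition sdelete (G : sgraph) (e : edge G) : sgraph :=
  @SGraph (delete e) (fun f => sign (val f)).

Definition scontract (G : sgraph) (e : edge G) : sgraph :=
  @SGraph (contract e) (fun f => sign (val f)).

Definition Zabd := {mpoly int[3]}.
Definition pA : Zabd := 'X_(inord 0).
Definition pB : Zabd := 'X_(inord 1).
Definition pd : Zabd := 'X_(inord 2).
Definition pX : Zabd := pA + pB * pd.
Definition pY : Zabd := pA * pd + pB.

(* The rules determining Q. A graph without vertices would need d^(-1), so it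
   is left out. *)
Record is_Q (Q : sgraph -> Zabd) : Prop := IsQ {
  Q_edgeless (G : sgraph) :
    #|edge G| = 0%N -> (0 < #|vertex G|)%N ->
    Q G = pd ^+ (#|vertex G| - 1);
  Q_loop (G : sgraph) (e : edge G) :
    is_loop e ->
    Q G = (if sign e then pY else pX) * Q (sdelete e);
  Q_nonloop (G : sgraph) (e : edge G) :
    ~~ is_loop e ->
    Q G = if sign e then pB * Q (sdelete e) + pA * Q (scontract e)
          else pA * Q (sdelete e) + pB * Q (scontract e)
}.

(* Existence and uniqueness of the polynomial described by [is_Q]: see
   [is_Q_state_sum] and [is_Q_unique]. *)
Lemma connect_adj_sym (G : graph) (S : {set edge G}) : connect_sym (adj S).
Proof.
by apply: sym_connect_sym => u v; apply: eq_existsb => e; rewrite orbC.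
Qed.

Lemma adjP (G : graph) (S : {set edge G}) u v :
  reflect (exists2 e, e \in S & ends e = (u, v) \/ ends e = (v, u)) (adj S u v).
Proof.
apply: (iffP existsP) => [[e /andP[eS /orP[]/eqP H]]|[e eS H]].
- by exists e => //; left.
- by exists e => //; right.
- by exists e; rewrite eS /=; case: H => ->; rewrite eqxx ?orbT.
Qed.

Section ComponentFacts.
Variable G : graph.
Implicit Types (e : edge G) (S : {set edge G}).

Definition edges_off e S : {set other_edge e} := [set f | val f \in S].

Lemma ncomp_delete e S : (e \in S -> is_loop e) ->
  @ncomp (delete e) (edges_off e S) = ncomp S.
Proof.
move=> He; apply: (@eq_n_comp (vertex G)) => u v.
apply/idP/idP; apply: connect_sub => {u v} u v /adjP[f fS Hf].
  by apply/connect1/adjP; exists (val f) => //; rewrite inE in fS.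
have [fe|fe] := eqVneq f e.
  move: He Hf; rewrite -fe => /(_ fS)/eqP E.
  by case=> H; move: E; rewrite H /= => ->; exact: connect0.
apply/connect1/adjP; exists (Sub f fe : other_edge e); first by rewrite inE.
by [].
Qed.

Lemma ncomp_contract e S : e \in S -> ~~ is_loop e ->
  @ncomp (contract e) (edges_off e S) = ncomp S.
Proof.
move=> eS Hl; symmetry; rewrite /ncomp.
have Hm w : connect (adj S) w (merge_vertex e w).
  rewrite /merge_vertex; case: eqP => [->|_]; last exact: connect0.
  by apply/connect1/adjP; exists e => //; right; case: (ends e).
have Hm' w : connect (adj S) (merge_vertex e w) w.
  by rewrite connect_adj_sym.
rewrite (@adjunction_n_comp _ _ (fun w : contr_vertex e => val w) (adj S)
  (@adj (contract e) (edges_off e S)) (connect_adj_sym S)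
  (@connect_adj_sym (contract e) _) predT) //.
apply: (@intro_adjunction _ _ _ _ _ (@connect_adj_sym (contract e) _) _ _
  (fun w _ => to_contr e w)) => // [w _|w _].
- split; first exact: Hm.
  move=> v _ /adjP[f fS Hf].
  have [fe|fe] := eqVneq f e.
    suff -> : to_contr e w = to_contr e v by exact: connect0.
    apply: val_inj; rewrite /= /merge_vertex.
    by rewrite -fe; case: Hf => ->; rewrite /= eqxx; case: eqP => // ->.
  apply/connect1/adjP; exists (Sub f fe : other_edge e); first by rewrite inE.
  by case: Hf => /= ->; [left|right].
- split.
    suff <- : w = to_contr e (val w) by exact: connect0.
    apply: val_inj; rewrite /= /merge_vertex; case: eqP => // E.
    by have := valP w; rewrite /= /kept E eqxx (negbTE Hl).
  move=> v /adjP[f]; rewrite inE => fS Hf.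
  have Hf' : connect (adj S) (ends (val f)).1 (ends (val f)).2.
    by apply/connect1/adjP; exists (val f) => //; left; case: (ends _).
  have {}Hf' := connect_trans (connect_trans (Hm' _) Hf') (Hm _).
  case: Hf => -[<- <-] //=; by rewrite connect_adj_sym.
Qed.

Lemma card_off e S : #|edges_off e S| = #|S :\ e|.
Proof.
rewrite -(card_imset _ val_inj); congr #|pred_of_set _|.
apply/setP=> f; rewrite !inE; apply/imsetP/andP.
  by case=> g; rewrite inE => gS ->; split=> //; exact: valP g.
by case=> fe fS; exists (Sub f fe : other_edge e); rewrite ?inE.
Qed.

Lemma card_other_edge e : #|edge G| = #|other_edge e|.+1.
Proof.
rewrite card_sig -cardsT (cardD1 e) !inE -[RHS]add1n; congr addn.
by apply: eq_card => f; rewrite !inE andbT.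
Qed.

Lemma card_contr_vertex e : ~~ is_loop e ->
  #|vertex G| = #|contr_vertex e|.+1.
Proof.
move=> Hl; rewrite card_sig -cardsT (cardD1 (ends e).2) !inE -[RHS]add1n; congr addn.
by apply: eq_card => f; rewrite !inE /kept (negbTE Hl) orbF andbT.
Qed.

Lemma ncomp_gt0 S : (0 < #|vertex G|)%N -> (0 < ncomp S)%N.
Proof.
case/card_gt0P=> v _; apply/card_gt0P; exists (fingraph.root (adj S) v).
by rewrite !inE /= roots_root //; exact: connect_adj_sym.
Qed.

Lemma ncomp0 : ncomp (set0 : {set edge G}) = #|vertex G|.
Proof.
apply: eq_card => v; rewrite !inE /= andbT /roots /=.
have /connectP[p Hp ->] := connect_root (adj set0) v.
by case: p Hp => [|w p] /=; [rewrite eqxx | case/andP=> /adjP[e]; rewrite inE].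
Qed.

End ComponentFacts.

Lemma nullity_ge0 (G : graph) (S : {set edge G}) :
  (#|vertex G| <= #|S| + ncomp S)%N.
Proof.
have [n] := ubnP #|edge G|; elim: n G S => // n IH G S Hn.
have [->|[e eS]] := set_0Vmem S; first by rewrite ncomp0 leq_addl.
have Hc := cardsD1 e S; rewrite eS -card_off in Hc.
rewrite (card_other_edge e) in Hn.
have [Hl|Hl] := boolP (is_loop e).
  have := IH (delete e) (edges_off e S) Hn; rewrite ncomp_delete // => H.
  by rewrite Hc add1n addSn; exact: leqW.
have := IH (contract e) (edges_off e S) Hn.
by rewrite ncomp_contract // (card_contr_vertex Hl) Hc.
Qed.

Definition state_exp (G : graph) (S : {set edge G}) : nat :=
  (ncomp S + nullity S - 1)%N.

(* The state sum satisfying the rules of [is_Q]. *)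
Definition state_sum (G : sgraph) : Zabd :=
  \sum_(S : {set edge G})
    (\prod_(e : edge G)
       (if (e \in S) == sign e then pA else pB)) * pd ^+ state_exp S.

Lemma sum_edge (R : nmodType) (G : graph) (e : edge G) (F : {set edge G} -> R) :
  \sum_S F S = \sum_(S : {set other_edge e}) (F (val @: S) + F (e |: val @: S)).
Proof.
rewrite big_split [LHS](bigID (fun S : {set edge G} => e \in S)) /= addrC; congr (_ + _).
- rewrite (reindex_onto (fun S : {set other_edge e} => val @: S) (edges_off e)) /=.
    apply: eq_bigl => S; apply/andP; split.
      by apply/imsetP => -[f _ E]; have := valP f; rewrite /= -E eqxx.
    by apply/eqP/setP => f; rewrite inE mem_imset //; exact: val_inj.
  move=> S eS; apply/setP => f; apply/imsetP/idP => [[g]|fS].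
    by rewrite inE => ? ->.
  have fe : f != e by apply: contraNneq eS => <-.
  by exists (Sub f fe : other_edge e); rewrite ?inE.
- rewrite (reindex_onto (fun S : {set other_edge e} => e |: val @: S) (edges_off e)) /=.
    apply: eq_bigl => S; rewrite setU11 /=.
    apply/eqP/setP => f; rewrite !inE (negbTE (valP f)) mem_imset //; exact: val_inj.
  move=> S eS; apply/setP => f; rewrite !inE; have [->//|fe] := eqVneq f e.
  apply/imsetP/idP => [[g]|fS]; first by rewrite inE => ? ->.
  by exists (Sub f fe : other_edge e); rewrite ?inE.
Qed.

Lemma off_imset (G : graph) (e : edge G) (S : {set other_edge e}) :
  edges_off e (val @: S) = S.
Proof. by apply/setP => f; rewrite inE mem_imset //; exact: val_inj. Qed.

Lemma off_imsetU (G : graph) (e : edge G) (S : {set other_edge e}) :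
  edges_off e (e |: val @: S) = S.
Proof.
apply/setP => f; rewrite !inE (negbTE (valP f)) mem_imset //; exact: val_inj.
Qed.

Lemma notin_imset (G : graph) (e : edge G) (S : {set other_edge e}) :
  e \notin val @: S.
Proof. by apply/imsetP => -[f _ E]; have := valP f; rewrite /= -E eqxx. Qed.

Lemma prod_edge (R : comNzRingType) (G : graph) (e : edge G) (F : edge G -> R) :
  \prod_f F f = F e * \prod_(f : other_edge e) F (val f).
Proof. by rewrite (bigD1 e) //= (big_sub (fun f => f != e)). Qed.

Lemma state_exp_delete (G : graph) (e : edge G) (S : {set other_edge e}) :
  state_exp (val @: S) = @state_exp (delete e) S.
Proof.
have := @ncomp_delete G e (val @: S); rewrite off_imset /state_exp /nullity.
move=> -> /=; last by rewrite (negbTE (notin_imset S)).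
by rewrite card_imset //; exact: val_inj.
Qed.

Lemma card_imsetU (G : graph) (e : edge G) (S : {set other_edge e}) :
  #|e |: val @: S| = #|S|.+1.
Proof. by rewrite cardsU1 notin_imset card_imset //; exact: val_inj. Qed.

Lemma state_exp_loop (G : graph) (e : edge G) (S : {set other_edge e}) :
  is_loop e -> state_exp (e |: val @: S) = (@state_exp (delete e) S).+1.
Proof.
move=> Hl; have := @ncomp_delete G e (e |: val @: S).
rewrite off_imsetU /state_exp /nullity card_imsetU => <- //=.
have := @nullity_ge0 (delete e) S => /=.
have : (0 < @ncomp (delete e) S)%N.
  by apply: ncomp_gt0; apply/card_gt0P; exists (ends e).1.
by lia.
Qed.

Lemma state_exp_contract (G : graph) (e : edge G) (S : {set other_edge e}) :
  ~~ is_loop e -> state_exp (e |: val @: S) = @state_exp (contract e) S.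
Proof.
move=> Hl; have := @ncomp_contract G e (e |: val @: S).
rewrite off_imsetU /state_exp /nullity card_imsetU => <- //=; last first.
  by rewrite setU11.
by rewrite (card_contr_vertex Hl) addSn subSS.
Qed.

Lemma state_sum_split (G : sgraph) (e : edge G) :
  state_sum G = \sum_(S : {set other_edge e})
    (\prod_(f : other_edge e) (if (f \in S) == sign (val f) then pA else pB)) *
    ((if sign e then pB else pA) * pd ^+ state_exp (val @: S)
     + (if sign e then pA else pB) * pd ^+ state_exp (e |: val @: S)).
Proof.
rewrite /state_sum (sum_edge e); apply: eq_bigr => S _.
rewrite !(prod_edge e) setU11 (negbTE (notin_imset S)) [_ == sign e]eq_sym.
rewrite (eq_bigr (fun f : other_edge e =>
  if (f \in S) == sign (val f) then pA else pB)); last first.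
  by move=> f _; rewrite mem_imset //; exact: val_inj.
rewrite mulrDr; congr (_ + _).
  by case: (sign e) => /=; rewrite mulrCA mulrA.
rewrite (eq_bigr (fun f : other_edge e =>
  if (f \in S) == sign (val f) then pA else pB)); last first.
  by move=> f _; rewrite !inE (negbTE (valP f)) mem_imset //; exact: val_inj.
by case: (sign e) => /=; rewrite mulrCA mulrA.
Qed.

Theorem is_Q_state_sum : is_Q state_sum.
Proof.
split=> [G E0 V0|G e Hl|G e Hl].
- have noE (e : edge G) : False by have := fintype0 e E0.
  rewrite /state_sum (bigD1 set0) //= big1; last by move=> e; case: (noE e).
  rewrite big1 ?addr0 ?mul1r; last by move=> S; case/set0Pn=> e; case: (noE e).
  by rewrite /state_exp /nullity ncomp0 cards0 add0n subnn addn0.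
- rewrite (state_sum_split e) /state_sum big_distrr /=; apply: eq_bigr => S _.
  rewrite state_exp_delete state_exp_loop // exprS /pX /pY.
  by case: (sign e); ring.
- rewrite (state_sum_split e) /state_sum.
  case: (sign e); rewrite !big_distrr -big_split /=; apply: eq_bigr => S _;
  rewrite state_exp_delete state_exp_contract //; ring.
Qed.

Theorem is_Q_unique (Q Q' : sgraph -> Zabd) : is_Q Q -> is_Q Q' ->
  forall G : sgraph, (0 < #|vertex G|)%N -> Q G = Q' G.
Proof.
move=> HQ HQ' G; have [n] := ubnP #|edge G|; elim: n G => // n IH G Hn V0.
have [/eqP E0|] := posnP #|edge G|.
  by move/eqP: E0 => E0; rewrite (Q_edgeless HQ) // (Q_edgeless HQ').
case/card_gt0P=> e _; rewrite (card_other_edge e) in Hn.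
have Ed : Q (sdelete e) = Q' (sdelete e) by apply: IH.
have [Hl|Hl] := boolP (is_loop e).
  by rewrite (Q_loop HQ Hl) (Q_loop HQ' Hl) Ed.
rewrite (Q_nonloop HQ Hl) (Q_nonloop HQ' Hl) Ed.
suff -> : Q (scontract e) = Q' (scontract e) by [].
by apply: IH => //; apply/card_gt0P; exists (to_contr e (ends e).1).
Qed.

(* [Chain k] and [Sheaf k] consist of k edges; k is required to be positive in
   [valid_repl]. *)
Variant repl := Chain of nat | Sheaf of nat.

Definition repl_size (r : repl) : nat :=
  match r with Chain k => k | Sheaf k => k end.

Definition inner_size (r : repl) : nat :=
  match r with Chain k => k.-1 | Sheaf _ => 0 end.

Variant color := ColC of int | ColS of int.

Section Replacement.
Variables (G : sgraph) (r : edge G -> repl).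

Definition valid_repl := forall e, (0 < repl_size (r e))%N.

Definition hat_edge : finType := {e : edge G & 'I_(repl_size (r e))}.

Definition inner_vertex : finType := {e : edge G & 'I_(inner_size (r e))}.

Definition hat_vertex : finType := (vertex G + inner_vertex)%type.

(* The j-th vertex (0 <= j <= k) of the chain u = p_0, p_1, ..., p_k = v that
   replaces e; p_j is the new vertex of index j - 1 when 0 < j < k. *)
Definition chain_vertex (e : edge G) (j : nat) : hat_vertex :=
  if j is j'.+1 then
    if (insub j' : option 'I_(inner_size (r e))) is Some i
    then inr (Tagged (fun e => 'I_(inner_size (r e))) i)
    else inl (ends e).2
  else inl (ends e).1.

Definition hat_ends (f : hat_edge) : hat_vertex * hat_vertex :=
  match r (tag f) with
  | Chain _ => (chain_vertex (tag f) (tagged f),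
                chain_vertex (tag f) (tagged f).+1)
  | Sheaf _ => (inl (ends (tag f)).1, inl (ends (tag f)).2)
  end.

Definition hat : sgraph :=
  @SGraph (Graph hat_ends) (fun f => sign (tag f)).

(* Length of the chain, or width of the sheaf, that replaces e. *)
Definition repl_length (e : edge G) : int :=
  \sum_(f : edge hat | tag f == e) (if sign f then 1 else -1).

Definition repl_color (e : edge G) : color :=
  match r e with
  | Chain _ => ColC (repl_length e)
  | Sheaf _ => ColS (repl_length e)
  end.

End Replacement.

(* W(G), with its indeterminates x_lambda, y_lambda, t, z_1, z_2 evaluated in a
   commutative ring. The truncated subtractions are exact when G has a vertex,
   since 1 <= k(G) <= k<S>. *)
Definition W (R : comNzRingType) (G : graph) (L : Type) (c : edge G -> L)
    (x y : L -> R) (t z1 z2 : R) : R :=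
  t ^+ (ncompG G - 1) *
  \sum_(S : {set edge G})
     (\prod_(e in S) x (c e)) * (\prod_(e in ~: S) y (c e)) *
     z1 ^+ (ncomp S - ncompG G) * z2 ^+ nullity S.

Definition xval (F : fieldType) (A B d X Y : F) (l : color) : F :=
  match l with
  | ColC n => A ^ n
  | ColS n => (Y ^ n - B ^ n) / d
  end.

Definition yval (F : fieldType) (A B d X Y : F) (l : color) : F :=
  match l with
  | ColC n => (X ^ n - A ^ n) / d
  | ColS n => B ^ n
  end.

Definition fracZabd := {fraction Zabd}.
Definition emb (p : Zabd) : fracZabd := FracField.tofrac p.

(* Rational functions in A, as the fraction field of Z[A]. *)
Definition fracZA := {fraction {poly int}}.
Definition aA : fracZA := FracField.tofrac 'X.
Definition aB : fracZA := aA^-1.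
Definition ad : fracZA := - aA ^+ 2 - aA ^- 2.
Definition aX : fracZA := - aA ^- 3.
Definition aY : fracZA := - aA ^+ 3.

(* B := A^-1 and d := - A^2 - A^-2 in an element of Z[A, B, d]. *)
Definition subst (p : Zabd) : fracZA :=
  mmap (intr : int -> fracZA) (fun i : 'I_3 => [:: aA; aB; ad]`_i) p.

(* Main.v *)
(* Q is the state sum over the sets S of edges of the hat graph of terms
   d^(k<S> + n<S> - 1). Such a set S determines the set T of edges of G whose
   replacement joins its two ends: the chains contained in S and the sheaves
   meeting S. A chain with j >= 1 edges missing adds j - 1 components and a
   sheaf with i >= 1 edges present adds i - 1 independent cycles, so the term of
   S is the term of T times a product of local factors. Summing the local
   factors over the states of one chain or sheaf is the binomial theorem, and
   gives x_c and y_c. In the Kauffman specialization A B = 1 = X Y, so that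
   exchanging A with B and X with Y, which is the effect of a negative sign,
   amounts to negating the exponent. *)
Require Import Defs.
From HB Require Import structures.
From mathcomp Require Import all_boot all_order all_algebra fraction.
From mathcomp Require Import mpoly zify ring.

Set Implicit Arguments.
Unset Strict Implicit.
Unset Printing Implicit Defensive.

Import GRing.Theory.
Local Open Scope ring_scope.

(** * Counting components of spanning subgraphs *)

(** The component roots attain every label, and distinct roots have distinct labels. *)
Lemma ncomp_labelling (G : graph) (S : {set edge G}) (L : finType)
    (f : vertex G -> L) :
  (forall u v, connect (adj S) u v = (f u == f v)) ->
  ncomp S = #|f @: [set: vertex G]|.
Proof.
move=> Hf; have Hsym := connect_adj_sym S.
rewrite /ncomp /n_comp_mem.
have -> : f @: [set: vertex G] = f @: [set v | roots (adj S) v].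
  apply/setP => l; apply/imsetP/imsetP => -[v _ ->].
    exists (fingraph.root (adj S) v); first by rewrite inE roots_root.
    by apply/eqP; rewrite -Hf connect_root.
  by exists v; rewrite ?inE.
rewrite card_in_imset => [|u v].
  by apply: eq_card => v; rewrite !inE /= andbT.
rewrite !inE => /eqP Hu /eqP Hv /eqP.
by rewrite -Hf -(root_connect Hsym) Hu Hv => /eqP.
Qed.

Lemma ncomp_root_image (G : graph) (S : {set edge G}) :
  ncomp S = #|fingraph.root (adj S) @: [set: vertex G]|.
Proof.
apply: ncomp_labelling => u v.
by rewrite (root_connect (connect_adj_sym S)).
Qed.

(** The root map of [S'] factors through the roots of [S]. This makes the exponent k<S> - k(G) in
    [W] exact. *)
Lemma leq_ncomp (G : graph) (S S' : {set edge G}) :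
  S \subset S' -> (ncomp S' <= ncomp S)%N.
Proof.
move=> sSS; rewrite !ncomp_root_image.
have sub u v : connect (adj S) u v -> connect (adj S') u v.
  apply: connect_sub => {}u {}v /adjP[e eS He].
  by apply/connect1/adjP; exists e => //; apply: (subsetP sSS).
have -> : fingraph.root (adj S') @: [set: vertex G]
   = fingraph.root (adj S') @: (fingraph.root (adj S) @: [set: vertex G]).
  rewrite -imset_comp; apply: eq_imset => v /=.
  apply/eqP; rewrite (root_connect (connect_adj_sym S')).
  by apply/sub/connect_root.
exact: leq_imset_card.
Qed.

(** * Chains, sheaves and the edges replacing a given edge *)

(** A boolean test avoids destructing [r e], on which the index types of new edges and vertices
    depend. *)
Definition is_chain (r : repl) := if r is Chain _ then true else false.

Lemma repl_caseE (T : Type) (r : repl) (a b : T) :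
  match r with Chain _ => a | Sheaf _ => b end = if is_chain r then a else b.
Proof. by case: r. Qed.

Lemma inner_sizeE (r : repl) :
  inner_size r = if is_chain r then (repl_size r).-1 else 0%N.
Proof. by case: r. Qed.

Lemma lt_inner_size (r : repl) p :
  (p < inner_size r)%N -> is_chain r /\ (p.+1 < repl_size r)%N.
Proof. by case: r => [k|k] //=; case: k. Qed.

Local Arguments chain_vertex {G} r e j : simpl never.

Section Hat.
Variables (G : sgraph) (r : edge G -> repl).
Hypothesis Hr : valid_repl r.
Implicit Types (e : edge G) (p q : nat).

Local Notation H := (hat r).
Local Notation len e := (repl_size (r e)).

Definition hat_edge_at (e : edge G) (i : 'I_(len e)) : edge H :=
  Tagged (fun e => 'I_(repl_size (r e))) i.

Definition fiber (e : edge G) : {set edge H} := [set f | tag f == e].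

Lemma fiber_at e (f : edge H) : f \in fiber e ->
  exists i : 'I_(len e), f = hat_edge_at i.
Proof. by case: f => e' i; rewrite inE /= => /eqP E; subst e'; exists i. Qed.

Lemma mem_fiber_at e (i : 'I_(len e)) : hat_edge_at i \in fiber e.
Proof. by rewrite inE. Qed.

Lemma hat_edge_at_inj e : injective (@hat_edge_at e).
Proof. by move=> i j /eqP; rewrite /hat_edge_at eq_Tagged => /eqP. Qed.

Lemma card_fiber e : #|fiber e| = len e.
Proof.
rewrite -[RHS]card_ord -cardsT -(card_imset _ (@hat_edge_at_inj e)).
congr #|pred_of_set _|; apply/setP => f; apply/idP/imsetP => [|[i _ ->]].
  by case/fiber_at=> i ->; exists i.
exact: mem_fiber_at.
Qed.

Lemma hat_endsE (f : edge H) :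
  ends f = if is_chain (r (tag f))
             then (chain_vertex r (tag f) (tagged f),
                   chain_vertex r (tag f) (tagged f).+1)
             else (inl (ends (tag f)).1, inl (ends (tag f)).2).
Proof. exact: repl_caseE. Qed.

(** * Components and exponent of a state of the hat graph *)

Section State.
Variable S : {set edge H}.

Definition joins (e : edge G) : bool :=
  if is_chain (r e) then fiber e \subset S else fiber e :&: S != set0.

Definition joined : {set edge G} := [set e | joins e].

(** For a chain: the absent edges met on the way from its first end to its [p]-th vertex. *)
Definition missing (e : edge G) (p : nat) : nat :=
  #|[set f in fiber e | (f \notin S) && (tagged f < p)%N]|.

Lemma missing0 e : missing e 0 = 0%N.
Proof. by apply: eq_card0 => f; rewrite !inE ltn0 !andbF. Qed.

Lemma missing_len e : missing e (len e) = #|fiber e :\: S|.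
Proof.
apply: eq_card => f; rewrite !inE andbC; case: eqP => [<-|_].
  by rewrite ltn_ord !andbT.
by rewrite !andbF.
Qed.

Lemma missingS e (i : 'I_(len e)) :
  missing e i.+1 = ((hat_edge_at i \notin S) + missing e i)%N.
Proof.
rewrite /missing (cardsD1 (hat_edge_at i)) !inE /= eqxx ltnSn andbT /=.
congr addn; apply: eq_card => f; rewrite !inE.
have [/fiber_at[j ->]|] := boolP (f \in fiber e); last first.
  by rewrite inE => /negbTE->; rewrite andbF.
rewrite /= /hat_edge_at eq_Tagged /= ltnS leq_eqVlt.
have [->|ne] := eqVneq i j; first by rewrite eqxx ltnn !andbF.
rewrite -(inj_eq val_inj) /= in ne.
by rewrite ![_ == i :> nat]eq_sym (negbTE ne).
Qed.

Lemma leq_missing e p q : (p <= q)%N -> (missing e p <= missing e q)%N.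
Proof.
move=> le_pq; apply/subset_leq_card/subsetP => f; rewrite !inE.
by case/and3P=> -> -> /leq_trans->.
Qed.

Lemma joined_chain e : is_chain (r e) ->
  (e \in joined) = (missing e (len e) == 0%N).
Proof. by move=> He; rewrite inE /joins He missing_len cards_eq0 setD_eq0. Qed.

(** Discrete intermediate values: the count starts at 0 and grows by at most 1 per edge. It yields a
    vertex for each label inside a chain. *)
Lemma missing_ivt e c : (c <= missing e (len e))%N ->
  exists2 p, (p <= len e)%N & missing e p = c.
Proof.
move: (leqnn (len e)); move: {1 3}(len e) => n.
elim: n => [_|n IH lt_n].
  by rewrite missing0 leqn0 => /eqP->; exists 0%N; rewrite ?missing0.
have := missingS (Ordinal lt_n) => /= Hn.
rewrite leq_eqVlt => /orP[/eqP->|Hc]; first by exists n.+1.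
apply: IH; first exact: ltnW.
move: Hc; rewrite Hn.
by case: (_ \notin S); rewrite ?add1n ?add0n //; exact: ltnW.
Qed.

(** With j >= 1 absent edges a chain falls into j + 1 pieces, two of which contain an end; the other
    j - 1 are new components. *)
Definition gaps (e : edge G) : nat :=
  if is_chain (r e) then (missing e (len e)).-1 else 0%N.

Definition gap : finType := {e : edge G & 'I_(gaps e)}.

Local Notation rt := (fingraph.root (adj joined)).

(* Walking along the chain of e, the number of missing edges already met
   identifies the component: no missing edge means the component of the first
   end, all of them the component of the second end, and the values in between
   number the components inside the chain. *)
Definition chain_label (e : edge G) (p : nat) : vertex G + gap :=
  if missing e p == 0%N then inl (rt (ends e).1)
  else if (insub (missing e p).-1 : option 'I_(gaps e)) is Some i
       then inr (Tagged (fun e => 'I_(gaps e)) i)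
       else inl (rt (ends e).2).

Definition label (x : vertex H) : vertex G + gap :=
  match x with
  | inl v => inl (rt v)
  | inr y => chain_label (tag y) (tagged y).+1
  end.

Lemma root_joined e : e \in joined -> rt (ends e).1 = rt (ends e).2.
Proof.
move=> eT; apply/eqP; rewrite (root_connect (connect_adj_sym joined)).
apply/connect1/adjP.
by exists e => //; left; case: (ends e).
Qed.

Lemma label_chain e p : is_chain (r e) -> (p <= len e)%N ->
  label (chain_vertex r e p) = chain_label e p.
Proof.
move=> He; case: p => [|p] lep; first by rewrite /chain_label missing0.
rewrite /chain_vertex; case: insubP => [i _ /= <- //|].
rewrite inner_sizeE He -leqNgt => lep'.
have -> : p.+1 = len e by move: (Hr e); lia.
(* At the far end, either [e] is joined and both ends have the same root, or the index equals
   [gaps e] and [insub] falls to its default, the root of the second end. *)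
rewrite /chain_label -joined_chain //; case: ifP => [/root_joined->//|].
by case: insubP => // i lti; rewrite /gaps He ltnn in lti.
Qed.

(** A present chain edge leaves the count of absent edges unchanged; a present sheaf edge makes its
    edge of [G] joined. *)
Lemma adj_label x y : adj S x y -> label x = label y.
Proof.
case/adjP=> f fS; rewrite hat_endsE.
suff : if is_chain (r (tag f))
       then label (chain_vertex r (tag f) (tagged f))
            = label (chain_vertex r (tag f) (tagged f).+1)
       else rt (ends (tag f)).1 = rt (ends (tag f)).2.
  by case: ifP => _ E [] [<- <-] //=; congr inl.
have [e [i Ef]] : exists e (i : 'I_(len e)), f = hat_edge_at i.
  by case: f {fS} => e i; exists e, i.
rewrite Ef /= in fS *; case: ifP => He; last first.
  apply: root_joined; rewrite inE /joins He; apply/set0Pn.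
  by exists (hat_edge_at i); rewrite !inE eqxx.
rewrite !label_chain ?(ltnW (ltn_ord i)) //.
by rewrite /chain_label missingS fS add0n.
Qed.

(** The count is monotone, so equal values at [p] and [q] mean that all edges between them are
    present. *)
Lemma connect_chain e p q : is_chain (r e) -> (p <= q <= len e)%N ->
  missing e p = missing e q ->
  connect (adj S) (chain_vertex r e p) (chain_vertex r e q).
Proof.
move=> He; elim: q => [|q IH] /andP[lepq leq].
  by move: lepq; rewrite leqn0 => /eqP->.
move: lepq; rewrite leq_eqVlt ltnS => /orP[/eqP->//|lepq] E.
have := missingS (Ordinal leq) => /= Eq.
have Epq : missing e p = missing e q.
  by have := leq_missing e lepq; move: E; rewrite Eq; lia.
apply: connect_trans (IH _ Epq) _; first by rewrite lepq ltnW.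
apply/connect1/adjP; exists (hat_edge_at (Ordinal leq)); last first.
  by left; rewrite hat_endsE /= He.
by apply: contraT => fS; move: E; rewrite Eq fS Epq; lia.
Qed.

Lemma chain_vertex_len e : is_chain (r e) ->
  chain_vertex r e (len e) = inl (ends e).2.
Proof.
move=> He; have := Hr e; case E: (len e) => [//|k] _.
rewrite /chain_vertex; case: insubP => // i lti.
by rewrite inner_sizeE He E ltnn in lti.
Qed.

(** Each joined edge is realised in [S] by its whole chain or by one edge of its sheaf. *)
Lemma connect_joined u v :
  connect (adj joined) u v -> connect (adj S) (inl u) (inl v).
Proof.
case/connectP=> s; elim: s u => [|w s IH] u /= => [_ ->//|/andP[uw ws] Ev].
apply: connect_trans (IH _ ws Ev); case/adjP: uw => e eT Ee.
suff : connect (adj S) (inl (ends e).1) (inl (ends e).2).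
  by case: Ee => -> //; rewrite connect_adj_sym.
have [He|He] := boolP (is_chain (r e)).
  rewrite -(chain_vertex_len He) -[inl _]/(chain_vertex r e 0).
  apply: connect_chain; rewrite ?leqnn //.
  by rewrite missing0; apply/esym/eqP; rewrite -joined_chain.
move: eT; rewrite inE /joins (negbTE He) => /set0Pn[f].
rewrite !inE => /andP[/eqP fe fS].
apply/connect1/adjP; exists f => //; left.
by rewrite hat_endsE; rewrite -fe in He *; rewrite (negbTE He).
Qed.

(** From an inner vertex with such a label the chain is intact back to its first end or onward to
    its second end. *)
Lemma label_inlP x v : label x = inl v -> connect (adj S) x (inl v).
Proof.
have base w : connect (adj S) (inl w) (inl (rt w)).
  exact/connect_joined/connect_root.
case: x => [w [<-]//|[e i]]; rewrite /label [tag _]/= [tagged _]/=.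
have [He lti] := lt_inner_size (ltn_ord i).
have -> : inr (existT _ e i) = chain_vertex r e i.+1.
  by rewrite /chain_vertex valK.
have lei : (i.+1 <= len e)%N by exact: ltnW.
rewrite /chain_label; case: eqP => [c0 [<-]|c0].
  apply: connect_trans (base _); rewrite connect_adj_sym.
  by apply: (@connect_chain e 0); rewrite ?missing0.
(* [insub] fails only when all absent edges of the chain are already behind. *)
case: insubP => // cl [<-].
apply: connect_trans (base _); rewrite -(chain_vertex_len He).
apply: connect_chain => //; first by rewrite lei /=.
have := leq_missing e lei.
by move: cl; rewrite /gaps He; lia.
Qed.

Lemma label_inrP x (g : gap) : label x = inr g ->
  exists p, [/\ is_chain (r (tag g)), (p <= len (tag g))%N,
    x = chain_vertex r (tag g) p & missing (tag g) p = (tagged g).+1].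
Proof.
case: x => [w //|[e i]]; rewrite /label [tag _]/= [tagged _]/=.
have [He lti] := lt_inner_size (ltn_ord i).
rewrite /chain_label; case: eqP => // c0.
case: insubP => // j _ Ej [<-] /=; exists i.+1; split=> //; first exact: ltnW.
  by rewrite /chain_vertex valK.
by rewrite Ej prednK // lt0n; apply/eqP.
Qed.

(** Labels are complete invariants of components: a left label leads to a vertex of [G], a right
    label fixes the chain and the count on it. *)
Lemma connect_label x y : connect (adj S) x y = (label x == label y).
Proof.
apply/idP/eqP => [/connectP[s]|].
  by elim: s x => [|z s IH] x /= => [_ ->//|/andP[/adj_label-> zs]]; exact: IH.
case Ey: (label y) => [v|g] Ex.
  apply: connect_trans (label_inlP Ex) _.
  by rewrite connect_adj_sym; apply: label_inlP.
have [p [He lep -> Ep]] := label_inrP Ex.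
have [q [_ leq -> Eq]] := label_inrP Ey.
have [lepq|/ltnW leqp] := leqP p q; last rewrite connect_adj_sym;
  by apply: connect_chain; rewrite ?Ep ?Eq // ?lepq ?leqp.
Qed.

(** Roots label themselves, and [missing_ivt] supplies every gap; this set is then easy to count. *)
Lemma label_image : label @: [set: vertex H] =
  [set l | if l is inl v then v \in roots (adj joined) else true].
Proof.
have Hsym := connect_adj_sym joined.
apply/setP => l; rewrite inE; apply/imsetP/idP => [[x _ ->]|].
  case E: (label x) => [v|//]; case: x E => [w [<-]|[e i]]; first exact: roots_root.
  rewrite /= /chain_label; case: ifP => _; first by case=> <-; exact: roots_root.
  by case: insubP => // _ [<-]; exact: roots_root.
case: l => [v /eqP Ev|[e i] _]; first by exists (inl v) => //; congr inl.
have [He lti] : is_chain (r e) /\ (i.+1 < missing e (len e))%N.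
  by move: (nat_of_ord i) (ltn_ord i) => n; rewrite /gaps; case: ifP => // _; lia.
have [|p lep Ep] := @missing_ivt e i.+1; first exact: ltnW.
exists (chain_vertex r e p) => //; rewrite label_chain // /chain_label Ep /=.
by rewrite valK.
Qed.

Lemma ncomp_hat : ncomp S = (ncomp joined + \sum_e gaps e)%N.
Proof.
rewrite (ncomp_labelling connect_label) label_image.
rewrite -sum1_card big_sumType /=; congr addn.
  under eq_bigl do rewrite inE.
  by rewrite sum1_card; apply: eq_card => v; rewrite [RHS]andbT.
under eq_bigl do rewrite inE.
rewrite sum1_card card_tagged sumnE big_map big_enum.
by apply: eq_bigr => e _; rewrite card_ord.
Qed.

Lemma card_hat_vertex :
  #|vertex H| = (#|vertex G| + \sum_e inner_size (r e))%N.
Proof.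
rewrite card_sum card_tagged sumnE big_map big_enum; congr addn.
by apply: eq_bigr => e _; rewrite card_ord.
Qed.

Lemma card_state : #|S| = (\sum_e #|fiber e :&: S|)%N.
Proof.
rewrite -sum1_card (partition_big (fun f : edge H => tag f) predT) //=.
apply: eq_bigr => e _; rewrite sum1_card; apply: eq_card => f.
by rewrite !inE andbC.
Qed.

(** The power of d that the replacement of [e] adds to the term of [joined]: extra components for a
    chain, extra cycles for a sheaf. Truncation gives 0 for an intact chain or an empty sheaf. *)
Definition excess (e : edge G) : nat :=
  if is_chain (r e) then #|fiber e :\: S|.-1 else #|fiber e :&: S|.-1.

Lemma state_exp_hat : (0 < #|vertex G|)%N ->
  state_exp S = (state_exp joined + \sum_e excess e)%N.
Proof.
move=> V0; have K0 := ncomp_gt0 joined V0; have N0 := nullity_ge0 joined.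
(* The exponent is 2k<S> + |S| - |V| - 1, so gaps count twice. The balance holds for each edge of
   [G] separately. *)
have : (\sum_e gaps e + \sum_e gaps e + #|S| =
        \sum_e inner_size (r e) + #|joined| + \sum_e excess e)%N.
  have -> : #|joined| = (\sum_e (e \in joined))%N by rewrite -sum1_card big_mkcond.
  rewrite card_state -!big_split /=; apply: eq_bigr => e _.
  have := cardsID S (fiber e); rewrite card_fiber.
  rewrite /gaps missing_len /excess inner_sizeE; have := Hr e.
  have [He|He] := boolP (is_chain (r e)).
    by rewrite joined_chain // missing_len; case: #|_ :\: _| => [|m] /=; lia.
  by rewrite inE /joins (negbTE He) -cards_eq0; case: #|_ :&: _| => [|m] /=; lia.
have := nullity_ge0 S.
by rewrite /state_exp /nullity ncomp_hat card_hat_vertex; lia.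
Qed.

End State.

(** * Factorisation of the state sum over the edges of G *)

Section FiberwiseSum.
Variables (R : comNzRingType) (a b : edge G -> R) (d : R).

Definition fiber_weight (e : edge G) (B : {set edge H}) : R :=
  a e ^+ #|fiber e :&: B| * b e ^+ #|fiber e :\: B| * d ^+ excess B e.

Lemma state_weight_fiber (S : {set edge H}) :
  (\prod_(f : edge H) (if f \in S then a (tag f) else b (tag f)))
    * d ^+ (\sum_e excess S e)
  = \prod_e fiber_weight e S.
Proof.
rewrite !big_split /= -prodrXr; congr (_ * _).
rewrite (partition_big (fun f : edge H => tag f) predT) //= -big_split.
apply: eq_bigr => e _; rewrite (bigID (mem S)) /=; congr (_ * _).
  rewrite -prodr_const; apply: eq_big => [f|f /andP[/eqP-> ->]//].
  by rewrite !inE.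
rewrite -prodr_const; apply: eq_big => [f|f /andP[/eqP-> /negbTE->]//].
by rewrite !inE andbC.
Qed.

Lemma fiber_weightI e B : fiber_weight e (fiber e :&: B) = fiber_weight e B.
Proof.
by rewrite /fiber_weight /excess setIA setIid setDIr setDv set0U.
Qed.

Lemma joinsI e B : joins (fiber e :&: B) e = joins B e.
Proof. by rewrite /joins setIA setIid subsetI subxx. Qed.

(** A state is a family of subsets of the fibers ([glue] and [restr] are inverse to each other), and
    [joined S = T] is a condition on each fiber alone, so distributivity applies. *)
Lemma fiberwise_sum (g : {set edge G} -> R) :
  \sum_(S : {set edge H}) (\prod_e fiber_weight e S) * g (joined S)
  = \sum_(T : {set edge G})
      (\prod_e \sum_(B : {set edge H} |
                       (B \subset fiber e) && (joins B e == (e \in T)))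
                  fiber_weight e B) * g T.
Proof.
rewrite (partition_big joined predT) //=; apply: eq_bigr => T _.
under eq_bigr => S /eqP-> do [].
rewrite -big_distrl bigA_distr_big_dep /=; congr (_ * _).
pose glue (h : {ffun edge G -> {set edge H}}) := \bigcup_e h e.
pose restr (S : {set edge H}) := [ffun e => fiber e :&: S].
have glueK S : glue (restr S) = S.
  apply/setP => f; apply/bigcupP/idP => [[e _]|fS].
    by rewrite ffunE inE => /andP[].
  by exists (tag f) => //; rewrite ffunE !inE eqxx.
have fiber_glue (h : {ffun edge G -> {set edge H}}) e :
    (forall e, h e \subset fiber e) -> fiber e :&: glue h = h e.
  move=> sub; apply/setP => f; rewrite !inE; apply/andP/idP => [[/eqP <-]|fh].
    case/bigcupP=> e' _ fe; have := subsetP (sub e') f fe.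
    by rewrite inE => /eqP->.
  by split; [have := subsetP (sub e) f fh; rewrite inE | apply/bigcupP; exists e].
rewrite (reindex_onto glue restr) //=.
apply: eq_big => [h|h /andP[_ /eqP E]]; last first.
  by apply: eq_bigr => e _; rewrite -[in RHS]E ffunE fiber_weightI.
apply/andP/familyP => [[/eqP Eh /eqP E] e|Hh].
  by rewrite -E ffunE unfold_in subsetIl joinsI -Eh inE eqxx.
have sub e : h e \subset fiber e by have := Hh e; rewrite unfold_in => /andP[].
split; last by apply/eqP/ffunP => e; rewrite ffunE fiber_glue.
apply/eqP/setP => e; rewrite inE -joinsI fiber_glue //.
by have := Hh e; rewrite unfold_in => /andP[_ /eqP].
Qed.

End FiberwiseSum.
End Hat.

(** * Binomial sums over the states of one chain or sheaf *)

(** Expand a product over all of [T]: an element outside [A] weighs 0 if chosen and 1 if not, so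
    only subsets of [A] survive. *)
Lemma sum_subsets (R : comNzRingType) (T : finType) (A : {set T}) (a c : R) :
  \sum_(B : {set T} | B \subset A) a ^+ #|A :&: B| * c ^+ #|A :\: B|
  = (a + c) ^+ #|A|.
Proof.
rewrite -prodr_const [RHS]big_mkcond /=.
have -> : \prod_i (if i \in A then a + c else 1)
  = \prod_i ((if i \in A then a else 0) + (if i \in A then c else 1)).
  by apply: eq_bigr => i _; case: ifP => // _; rewrite add0r.
rewrite bigA_distr /= big_mkcond; apply: eq_bigr => B _.
case: ifP => [sBA|/negbT/subsetPn[i iB iA]]; last first.
  by rewrite (bigD1 i) //= iB (negbTE iA) mul0r.
rewrite -!prodr_const big_mkcond [X in _ * X]big_mkcond -big_split /=.
apply: eq_bigr => i _; rewrite !inE.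
have := subsetP sBA i; case: (i \in B) => [->//|_]; rewrite ?mulr1 //.
by rewrite andbF mul1r.
Qed.

(** States of an unjoined chain. The outer [d] completes each power, turning b^m d^(m-1) into (b
    d)^m; what remains is the binomial sum without its top term. *)
Lemma sum_proper_subsets (R : comNzRingType) (T : finType) (A : {set T})
    (a b d : R) :
  d * (\sum_(B : {set T} | (B \subset A) && ~~ (A \subset B))
     a ^+ #|A :&: B| * b ^+ #|A :\: B| * d ^+ #|A :\: B|.-1)
  = (a + b * d) ^+ #|A| - a ^+ #|A|.
Proof.
rewrite -sum_subsets [X in _ = X - _](bigD1 A) //= setIid setDv cards0 mulr1.
rewrite [X in X - _]addrC addrK.
rewrite big_distrr; apply: eq_big => [B|B /andP[_ nAB]].
  by rewrite eqEsubset; case: (B \subset A).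
have : (0 < #|A :\: B|)%N by rewrite card_gt0 setD_eq0.
by case: #|_ :\: _| => // m _; rewrite exprMn [d ^+ m.+1]exprS /=; ring.
Qed.

(** States of a joined sheaf: the binomial sum without the term of the empty set. *)
Lemma sum_nonempty_subsets (R : comNzRingType) (T : finType) (A : {set T})
    (a b d : R) :
  d * (\sum_(B : {set T} | (B \subset A) && (A :&: B != set0))
     a ^+ #|A :&: B| * b ^+ #|A :\: B| * d ^+ #|A :&: B|.-1)
  = (b + a * d) ^+ #|A| - b ^+ #|A|.
Proof.
rewrite [b + _]addrC -sum_subsets [X in _ = X - _](bigD1 set0) ?sub0set //=.
rewrite setI0 setD0 cards0 mul1r [X in X - _]addrC addrK.
rewrite big_distrr; apply: eq_big => [B|B /andP[_]].
  by case: (boolP (B \subset A)) => //= /setIidPr ->.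
rewrite -card_gt0; case: #|_ :&: _| => // m _.
by rewrite exprMn [d ^+ m.+1]exprS /=; ring.
Qed.

(** * Comparison of the two state sums *)

(** Values are prescribed after multiplication by [d], so that the lemma serves both Z[A,B,d] and
    the field of the Kauffman specialization. Weights vary with [e] to account for signs. *)
Lemma hat_state_sum (R : idomainType) (G : sgraph) (r : edge G -> repl)
    (a b x y : edge G -> R) (d : R) :
  valid_repl r -> (0 < #|vertex G|)%N -> d != 0 ->
  (forall e, let k := repl_size (r e) in
     if is_chain (r e)
     then x e = a e ^+ k /\ d * y e = (a e + b e * d) ^+ k - a e ^+ k
     else y e = b e ^+ k /\ d * x e = (b e + a e * d) ^+ k - b e ^+ k) ->
  \sum_(S : {set edge (hat r)})
     (\prod_f (if f \in S then a (tag f) else b (tag f))) * d ^+ state_exp S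
  = \sum_(T : {set edge G})
     (\prod_e (if e \in T then x e else y e)) * d ^+ state_exp T.
Proof.
move=> Hr V0 d0 Hxy.
under eq_bigr => S _ do
  rewrite state_exp_hat // addnC exprD mulrA state_weight_fiber.
rewrite (fiberwise_sum r a b d (fun T : {set edge G} => d ^+ state_exp T)).
apply: eq_bigr => T _; congr (_ * _); apply: eq_bigr => e _.
have := Hxy e; rewrite -card_fiber /fiber_weight /excess /joins.
have cancel := mulfI d0.
(* A joined chain and an unjoined sheaf have one state each; the two other cases are the binomial
   sums. *)
case: ifP => He [E1 E2]; case: (e \in T).
- rewrite (big_pred1 (fiber r e)); first by rewrite setIid setDv cards0 !mulr1.
  by move=> B /=; rewrite eqb_id -eqEsubset.
- apply: cancel; rewrite E2 -sum_proper_subsets; congr (_ * _).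
  by apply: eq_bigl => B; rewrite eqbF_neg.
- apply: cancel; rewrite E2 -sum_nonempty_subsets; congr (_ * _).
  by apply: eq_bigl => B; rewrite eqb_id.
- rewrite (big_pred1 set0) ?setI0 ?setD0 ?cards0 ?mulr1 ?mul1r // => B /=.
  rewrite eqbF_neg negbK; apply/andP/eqP => [[/setIidPr-> /eqP]//|->].
  by rewrite sub0set setI0.
Qed.

(** The exponents k(G) - 1, k<S> - k(G) and n<S> telescope. *)
Lemma W_state_sum (R : comNzRingType) (G : graph) (L : Type) (c : edge G -> L)
    (x y : L -> R) (d : R) : (0 < #|vertex G|)%N ->
  W c x y d d d =
  \sum_(S : {set edge G})
     (\prod_e (if e \in S then x (c e) else y (c e))) * d ^+ state_exp S.
Proof.
move=> V0; rewrite /W big_distrr /=; apply: eq_bigr => S _.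
have -> : \prod_e (if e \in S then x (c e) else y (c e)) =
    (\prod_(e in S) x (c e)) * (\prod_(e in ~: S) y (c e)).
  rewrite (bigID (mem S)) /=; congr (_ * _).
    by apply: eq_bigr => e ->.
  by apply: eq_big => [e|e /negbTE->//]; rewrite inE.
rewrite mulrC -!mulrA; congr (_ * (_ * _)); rewrite -!exprD; congr (_ ^+ _).
have := ncomp_gt0 [set: edge G] V0; have := leq_ncomp (subsetT S).
by rewrite /state_exp /ncompG; lia.
Qed.

(** * Signed lengths and the substituted values *)

Lemma repl_lengthE (G : sgraph) (r : edge G -> repl) (e : edge G) :
  repl_length r e = (if sign e then 1 else -1) * (repl_size (r e))%:Z.
Proof.
rewrite /repl_length (eq_bigr (fun _ => if sign e then 1 else -1)); last first.
  by move=> f /eqP <-.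
rewrite sumr_const -mulr_natr natz; congr (_ * Posz _).
by rewrite -card_fiber; apply: eq_card => f; rewrite !inE.
Qed.

Lemma repl_colorE (G : sgraph) (r : edge G -> repl) (e : edge G) :
  repl_color r e =
  if is_chain (r e) then ColC (repl_length r e) else ColS (repl_length r e).
Proof. exact: repl_caseE. Qed.

(** Splitting by presence gives weights constant on each fiber, as [hat_state_sum] requires. *)
Lemma state_sum_hat (G : sgraph) (r : edge G -> repl) :
  state_sum (hat r) =
  \sum_(S : {set edge (hat r)})
     (\prod_(f : edge (hat r))
        (if f \in S then if sign (tag f) then pA else pB
         else if sign (tag f) then pB else pA)) * pd ^+ state_exp S.
Proof.
apply: eq_bigr => S _; congr (_ * _); apply: eq_bigr => f _ /=.
by case: (f \in S); case: (sign _).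
Qed.

(** The quotient of (u + bd)^k - u^k by d, written without division through the factorisation of a
    difference of powers. *)
Definition diff_quot (R : comNzRingType) (u b d : R) (k : nat) : R :=
  b * \sum_(i < k) (u + b * d) ^+ (k.-1 - i) * u ^+ i.

Lemma mul_diff_quot (R : comNzRingType) (u b d : R) k :
  d * diff_quot u b d k = (u + b * d) ^+ k - u ^+ k.
Proof. by rewrite subrXX [u + _]addrC addrK mulrA [d * b]mulrC [b * d + _]addrC. Qed.

Lemma pd_neq0 : pd != 0.
Proof.
apply/eqP => /(congr1 (mcoeff U_(inord 2)%MM)).
by rewrite mcoeffX eqxx mcoeff0 => /eqP; rewrite oner_eq0.
Qed.

Lemma aA_neq0 : aA != 0.
Proof. by rewrite tofrac_eq0 polyX_eq0. Qed.

Section KauffmanValues.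
Variables (F : fieldType) (A : F).
Hypothesis A0 : A != 0.
Let d : F := - A ^+ 2 - A ^- 2.

(** Shows that [d] is nonzero as soon as A^4 + 1 is. *)
Lemma kauffman_dE : A ^+ 4 + 1 = - A ^+ 2 * d.
Proof. by rewrite /d; field. Qed.

Lemma kauffman_XE : - A ^- 3 = A + A^-1 * d.
Proof. by rewrite /d; field. Qed.

Lemma kauffman_YE : - A ^+ 3 = A^-1 + A * d.
Proof. by rewrite /d; field. Qed.

End KauffmanValues.

Lemma ad_neq0 : ad != 0.
Proof.
have : aA ^+ 4 + 1 != 0.
  rewrite -tofracXn -tofrac1 -tofracD tofrac_eq0 -size_poly_eq0.
  by rewrite size_polyDl size_polyXn // size_poly1.
by rewrite (kauffman_dE aA_neq0) -/ad; apply: contraNneq => ->; rewrite mulr0.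
Qed.

Lemma aXE : aX = aA + aB * ad.
Proof. exact: kauffman_XE aA_neq0. Qed.

Lemma aYE : aY = aB + aA * ad.
Proof. exact: kauffman_YE aA_neq0. Qed.

Lemma aX_inv : aX^-1 = aY.
Proof. by rewrite /aX /aY invrN invrK. Qed.

HB.instance Definition _ := GRing.RMorphism.copy subst
  (mmap (intr : int -> fracZA) (fun i : 'I_3 => [:: aA; aB; ad]`_i)).

Lemma subst_var (i : 'I_3) : subst 'X_i = [:: aA; aB; ad]`_i.
Proof. by rewrite /subst mmapX mmap1U. Qed.

Lemma subst_pA : subst pA = aA.
Proof. by rewrite subst_var inordK. Qed.

Lemma subst_pB : subst pB = aB.
Proof. by rewrite subst_var inordK. Qed.

Lemma subst_pd : subst pd = ad.
Proof. by rewrite subst_var inordK. Qed.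

(** * The replacement formula *)

Theorem theorem8 (Q : sgraph -> Zabd) (HQ : is_Q Q)
    (G : sgraph) (Gne : (0 < #|vertex G|)%N)
    (r : edge G -> repl) (Hr : valid_repl r) :
  ((forall e : edge G, (0 < repl_length r e)%R) ->
     exists x y : color -> Zabd,
       [/\ forall e : edge G,
             emb (x (repl_color r e)) =
             xval (emb pA) (emb pB) (emb pd) (emb pX) (emb pY)
                  (repl_color r e),
           forall e : edge G,
             emb (y (repl_color r e)) =
             yval (emb pA) (emb pB) (emb pd) (emb pX) (emb pY)
                  (repl_color r e)
         & Q (hat r) = W (repl_color r) x y pd pd pd]) /\
  subst (Q (hat r)) =
    W (repl_color r) (xval aA aB ad aX aY) (yval aA aB ad aX aY) ad ad ad.
Proof.
have -> : Q (hat r) = state_sum (hat r).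
  apply: (is_Q_unique HQ is_Q_state_sum).
  by rewrite card_hat_vertex; apply: leq_trans Gne (leq_addr _ _).
split=> [pos|].
  (* A length is the sign times a number of edges, so positivity forces every sign to be +. *)
  have len e : sign e /\ repl_length r e = (repl_size (r e))%:Z.
    have := pos e; rewrite repl_lengthE; case: (sign e); first by rewrite mul1r.
    by lia.
  exists (fun l => match l with
    | ColC n => pA ^+ `|n|%N
    | ColS n => diff_quot pB pA pd `|n|%N
    end).
  exists (fun l => match l with
    | ColC n => diff_quot pA pB pd `|n|%N
    | ColS n => pB ^+ `|n|%N
    end).
  have emb_quot u b k :
      emb (diff_quot u b pd k) = (emb (u + b * pd) ^+ k - emb u ^+ k) / emb pd.
    have ed0 : emb pd != 0 by rewrite tofrac_eq0 pd_neq0.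
    apply: (mulfI ed0); rewrite [RHS]mulrC divfK //.
    by rewrite /emb -tofracM mul_diff_quot tofracB !tofracXn.
  split=> [e|e|].
  - rewrite repl_colorE; have [_ ->] := len e; case: (is_chain _) => /=.
      exact: tofracXn.
    by rewrite emb_quot /pY [pA * _ + _]addrC.
  - rewrite repl_colorE; have [_ ->] := len e; case: (is_chain _) => /=.
      exact: emb_quot.
    exact: tofracXn.
  rewrite W_state_sum // state_sum_hat.
  apply: (@hat_state_sum _ _ _ (fun e => if sign e then pA else pB)
    (fun e => if sign e then pB else pA)) => // [|e]; first exact: pd_neq0.
  rewrite repl_colorE; have [-> ->] := len e.
  by case: (is_chain _); rewrite /= mul_diff_quot.
rewrite state_sum_hat rmorph_sum W_state_sum //=.
under eq_bigr => S _.
  rewrite rmorphM rmorphXn rmorph_prod /= subst_pd.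
  under eq_bigr => f _ do
    rewrite !(fun_if subst) subst_pA subst_pB.
  over.
apply: (@hat_state_sum _ _ _ (fun e => if sign e then aA else aB)
    (fun e => if sign e then aB else aA)) => // [|e]; first exact: ad_neq0.
have cancel z : ad * (z / ad) = z by rewrite mulrC divfK // ad_neq0.
rewrite repl_colorE repl_lengthE /=.
case: (sign e); case: (is_chain _); rewrite /= ?mul1r ?mulN1r cancel ?aXE ?aYE //.
(* Negative chain of k edges: A^(-k) = B^k and X^(-k) = Y^k, which are the values for exchanged
   weights. The sheaf case is dual. *)
- by rewrite -!exprnN -!exprVn -aXE aX_inv aYE.
- by rewrite -!exprnN -!exprVn -aYE -aX_inv invrK aXE /aB invrK.
Qed.
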